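(* Let $X,E,Y,d,\mathcal{N},\hat{\mathcal{N}},|\cdot|,\alpha,\beta,\gamma$ be as in the context. Let $\lambda_n>0$ and $a_n\geq 0$, $n\in\mathbb{N}=\{0,1,2,\dots\}$, satisfy $$a_n\leq a_{n-1}\ \text{for any }n\geq 1,\qquad \lim_n a_n=0,\qquad \limsup_n\frac{2^{\beta n}}{\lambda_n}<+\infty.$$ Let $\{\sigma_n\}_{n\in\mathbb{N}}$ be any sequence such that $\sigma_0$ is a minimizer of $$\min\left\{\lambda_0[d(\hat{\mathcal{N}},\mathcal{N}(\sigma))^{\alpha}+a_0|\sigma|^{\gamma}]+|\sigma|^{\beta}:\ \sigma\in E\right\}$$ and, for $n\geq 1$, $\sigma_n$ is a minimizer of $$\min\left\{\lambda_n[d(\hat{\mathcal{N}},\mathcal{N}(\tilde{\sigma}_{n-1}+\sigma))^{\alpha}+a_n|\tilde{\sigma}_{n-1}+\sigma|^{\gamma}]+|\sigma|^{\beta}:\ \tilde{\sigma}_{n-1}+\sigma\in E\right\},$$ where $\tilde{\sigma}_{n}=\sum_{j=0}^{n}\sigma_j$. Let $\delta_0=\inf\{d(\hat{\mathcal{N}},\mathcal{N}(\sigma)):\ \sigma\in E\}$ and $$\varepsilon_0=\lim_n\left(d(\hat{\mathcal{N}},\mathcal{N}(\tilde{\sigma}_n))^{\alpha}+a_n|\tilde{\sigma}_n|^{\gamma}\right)^{1/\alpha}$$ (the limit exists, the sequence being nonincreasing). Then $\varepsilon_0=\delta_0$ and $$\lim_n d(\hat{\mathcal{N}},\mathcal{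N}(\tilde{\sigma}_n))=\delta_0.$$
   Context: $X$ is a real Banach space with norm $\|\cdot\|$; $E$ is a closed nonempty subset of $X$; $Y$ is a metric space with distance $d$; $\mathcal{N}:E\to Y$ is a (possibly nonlinear) map and $\hat{\mathcal{N}}\in Y$, such that the function $E\ni\sigma\mapsto d(\hat{\mathcal{N}},\mathcal{N}(\sigma))$ is continuous with respect to the norm of $X$. There is a function $|\cdot|:X\to[0,+\infty]$ such that: 1) $|0|=0$ and $|-x|=|x|$ for any $x\in X$; 2) $|x+y|\leq|x|+|y|$ for any $x,y\in X$; 3) $\{x\in E:\ |x|<+\infty\}$ is dense in $E$; 4) $\{x\in X:\ |x|\leq b\}$ is relatively sequentially compact in $X$ for any $b\in\mathbb{R}$; 5) $|\cdot|$ is sequentially lower semicontinuous on $X$ with respect to norm convergence. $\alpha,\beta,\gamma$ are fixed positive constants. These assumptions guarantee that sequences $\{\sigma_n\}$ as in the claim exist (not necessarily unique). *)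

(* Defs.v *)
From mathcomp Require Import all_boot all_order all_algebra.
From mathcomp Require Import all_classical all_reals all_analysis.
Import Order.TTheory GRing.Theory Num.Theory.
Import numFieldNormedType.Exports.

Set Implicit Arguments.
Unset Strict Implicit.
Unset Printing Implicit Defensive.

Local Open Scope classical_set_scope.
Local Open Scope ring_scope.

Definition minimizer (R : realType) (T : Type) (A : set T) (f : T -> \bar R)
    (x : T) : Prop :=
  A x /\ (forall y, A y -> (f x <= f y)%E).

(* The limit of the subsequence is not required to lie in [A]. *)
Definition relatively_seq_compact (T : ptopologicalType) (A : set T) : Prop :=
  forall u : nat -> T, (forall n, A (u n)) ->
  exists2 k : nat -> nat, {homo k : m n / (m < n)%N} & cvgn (u \o k).

Definition seq_lower_semicontinuous (R : realType) (T : topologicalType)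
    (f : T -> \bar R) : Prop :=
  forall (u : nat -> T) (x : T), u @ \oo --> x ->
  (f x <= limn_einf (f \o u))%E.

Section multiscale.
Context {R : realType} {X : completeNormedModType R} {Y : metricType R}.
Implicit Types (N : X -> Y) (Nhat : Y) (p : X -> \bar R) (a l : R).

(* [p] is the extended-valued function |.|. The products with [+oo] follow the
   library convention [0 * +oo = 0]; this is immaterial in the objectives
   below, where the last summand is [+oo] whenever this case occurs. *)
Definition penalized_misfit N Nhat p (alpha gamma a : R) (x : X) : \bar R :=
  (((mdist Nhat (N x)) `^ alpha)%:E + a%:E * p x `^ gamma)%E.

Definition objective N Nhat p (alpha beta gamma l a : R) (x0 s : X) : \bar R :=
  (l%:E * penalized_misfit N Nhat p alpha gamma a (x0 + s)%R + p s `^ beta)%E.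

Definition psum (sigma : nat -> X) (n : nat) : X := \sum_(j < n.+1) sigma j.

Definition multiscale_seq (E : set X) N Nhat p (alpha beta gamma : R)
    (lambda a : nat -> R) (sigma : nat -> X) : Prop :=
  minimizer E (objective N Nhat p alpha beta gamma (lambda 0%N) (a 0%N) 0)
    (sigma 0%N) /\
  (forall n : nat,
    minimizer [set s | E (psum sigma n + s)]
      (objective N Nhat p alpha beta gamma (lambda n.+1) (a n.+1)
        (psum sigma n))
      (sigma n.+1)).

End multiscale.

(* Main.v *)
(* Testing minimality with the zero increment shows that the penalized misfits
   [f n] are nonincreasing and that all partial sums have finite penalty.
   Suppose [L <= f n] for all [n], while some [z] in [E] with [p z < +oo]
   satisfies [mdist Nhat (N z) `^ alpha < L].  Put [r n = p (z - psum n)] and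
   [s n = p (sigma n.+1)].  Testing with the increment [z - psum n] gives, for
   some [c > 0] and large [n], [c * lambda n.+1 + s n `^ beta <= r n `^ beta],
   whereas [r n.+1 <= r n + s n].  Hence [s n <= r n] and [r n = O(2 ^ n)].  As
   [lambda n] grows at least like [2 ^ (beta n)], the gap term prevents [r] from
   actually doubling, so that [r n = o(2 ^ n)], contradicting
   [c * lambda n.+1 <= r n `^ beta]. *)
Require Import Defs.
From mathcomp Require Import all_boot all_order all_algebra.
From mathcomp Require Import all_classical all_reals all_analysis.
From mathcomp Require Import lra.
Import Order.TTheory GRing.Theory Num.Theory.
Import numFieldNormedType.Exports.
Local Open Scope classical_set_scope.
Local Open Scope ring_scope.

(** * Real powers: monotonicity, inversion, continuity *)

Lemma ler_powR2r {R : realType} {b x y : R} : 0 < b -> 0 <= x -> 0 <= y ->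
  (x `^ b <= y `^ b) = (x <= y).
Proof.
move=> b0 x0 y0; have [xy|yx] := leP x y.
  by apply: ge0_ler_powR; rewrite ?nnegrE// ltW.
by apply/negbTE; rewrite -ltNge gt0_ltr_powR.
Qed.

Lemma powRK {R : realType} {b x : R} : b != 0 -> 0 <= x ->
  (x `^ b) `^ b^-1 = x.
Proof. by move=> b0 x0; rewrite -powRrM mulfV// powRr1. Qed.

Lemma powRVK {R : realType} {b x : R} : b != 0 -> 0 <= x ->
  (x `^ b^-1) `^ b = x.
Proof. by move=> b0 x0; rewrite -powRrM mulVf// powRr1. Qed.

Lemma continuous_powR {R : realType} (b : R) {x : R} : 0 < x ->
  {for x, continuous (fun y => y `^ b)}.
Proof.
move=> x0; apply: differentiable_continuous; apply/derivable1_diffP.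
by apply: derivable_powR; rewrite in_itv/= x0.
Qed.

(* [t n = r n / 2 ^ n] decreases to a limit [tau > 0] and
   [s n / 2 ^ n >= 2 * t n.+1 - t n]; in the limit the gap inequality reads
   [c + tau `^ b <= tau `^ b]. *)
Lemma powR_gap_doubling (R : realType) (b c : R) (r s : nat -> R) :
  0 < b -> 0 < c -> (forall n, 0 <= r n) -> (forall n, 0 <= s n) ->
  (forall n, c * 2 `^ (b * n%:R) + s n `^ b <= r n `^ b) ->
  (forall n, r n.+1 <= r n + s n) -> False.
Proof.
move=> b0 c0 r0 s0 gap rS.
have pow2_gt0 n : 0 < (2 : R) ^+ n by rewrite exprn_gt0.
pose t n := r n / 2 ^+ n; pose w n := s n / 2 ^+ n.
have t0 n : 0 <= t n by rewrite divr_ge0// ltW.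
have w0 n : 0 <= w n by rewrite divr_ge0// ltW.
have tw n : c + w n `^ b <= t n `^ b.
  rewrite -(ler_pM2r (powR_gt0 b (pow2_gt0 n))) mulrDl.
  rewrite -!powRM ?(ltW (pow2_gt0 n))//.
  rewrite !divfK ?gt_eqF// -powR_mulrn// -powRrM [n%:R * b]mulrC.
  exact: gap.
have tS n : 2 * t n.+1 <= t n + w n.
  rewrite /t /w -mulrDl exprS invfM mulrA mulrACA mulfV// mul1r.
  by rewrite ler_pM2r ?invr_gt0.
have wt n : w n <= t n.
  rewrite -(ler_powR2r b0)//; apply: le_trans (tw n).
  by rewrite lerDr ltW.
have t_noninc : {homo t : m n / (m <= n)%N >-> n <= m}.
  by apply/nonincreasing_seqP => n; have := tS n; have := wt n; lra.
have t_cvg : cvgn t.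
  by apply: nonincreasing_is_cvgn => //; exists 0 => _ [n _ <-].
pose e := c `^ b^-1.
have e0 : 0 < e by rewrite powR_gt0.
have et n : e <= t n.
  rewrite -(ler_powR2r b0) ?powR_ge0// powRVK ?gt_eqF// ?(ltW c0)//.
  by apply: le_trans (tw n); rewrite lerDl powR_ge0.
have tau0 : 0 < limn t.
  by apply: lt_le_trans e0 _; apply: limr_ge => //; apply: nearW.
have tSt_cvg : (fun n => 2 * t n.+1 - t n) @ \oo --> limn t.
  rewrite [X in _ --> X](_ : _ = 2 * limn t - limn t); last by lra.
  apply: cvgB => //; apply: cvgM; first exact: cvg_cst.
  by rewrite (cvg_shiftS t).
have powt_cvg : (fun n => t n `^ b) @ \oo --> limn t `^ b.
  apply: (@continuous_cvg _ _ _ _ _ _ (fun y => y `^ b)) t_cvg.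
  exact: continuous_powR.
have powtS_cvg : (fun n => c + (2 * t n.+1 - t n) `^ b) @ \oo -->
    c + limn t `^ b.
  apply: cvgD; first exact: cvg_cst.
  apply: (@continuous_cvg _ _ _ _ _ _ (fun y => y `^ b)) tSt_cvg.
  exact: continuous_powR.
suff : c + limn t `^ b <= limn t `^ b by rewrite gerDr leNgt c0.
rewrite -(cvg_lim _ powtS_cvg)// -(cvg_lim _ powt_cvg)//.
apply: ler_lim; [by apply/cvg_ex; eexists; exact: powtS_cvg |
  by apply/cvg_ex; eexists; exact: powt_cvg |].
(* The positive limit makes [2 * t n.+1 - t n] eventually positive, so its power can be compared
   with that of [w n]. *)
apply: filterS (cvgr_gt _ tSt_cvg _ tau0) => n tSn0.
apply: le_trans (tw n); rewrite lerD2l (ler_powR2r b0)// ?(ltW tSn0)//.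
by have := tS n; lra.
Qed.

(** * Bounds from a finite limsup, and values near a dense subset *)

Lemma limn_esup_bounded (R : realType) (u : nat -> R) :
  (limn_esup (fun n => (u n)%:E) < +oo)%E ->
  exists M, \forall n \near \oo, u n <= M.
Proof.
move=> /ereal_inf_lt[_ [V Voo <-]] supV.
case E : (ereal_sup _) supV => [M| |]// _.
- exists M; apply: filterS Voo => n Vn; rewrite -lee_fin -E.
  by apply: ereal_sup_ubound; exists n.
(* The witness is arbitrary: a supremum [-oo] cannot dominate a real value [u n]. *)
- exists 0; apply: filterS Voo => n Vn.
  suff : ((u n)%:E <= -oo)%E by rewrite leeNy_eq.
  by rewrite -E; apply: ereal_sup_ubound; exists n.
Qed.

(** The set where [g < y] is a neighbourhood of [x] relative to [E], so it meets the dense part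
    [A]. *)
Lemma within_continuous_lt_dense (R : realType) (X : topologicalType)
    (E A : set X) (g : X -> R) (x : X) (y : R) :
  {within E, continuous g} -> E `<=` closure (E `&` A) ->
  E x -> g x < y -> exists z, [/\ E z, A z & g z < y].
Proof.
move=> gE EA Ex gxy.
have : \forall z \near within E (nbhs x), g z < y.
  rewrite nbhs_subspace_in//.
  by apply: (cvgr_lt _ (gE x)).
move=> /(EA _ Ex) [z [[Ez Az] zE]].
by exists z; split=> //; exact: zE.
Qed.

(** * Finite penalties and minimality along the sequence *)

Section multiscale_seq_theory.
Context {R : realType} {X : completeNormedModType R} {Y : metricType R}.
Variables (E : set X) (N : X -> Y) (Nhat : Y) (p : X -> \bar R).
Variables (alpha beta gamma : R) (lambda a : nat -> R) (sigma : nat -> X).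
Hypotheses (p_ge0 : forall x, (0 <= p x)%E) (p0 : p 0 = 0%E).
Hypothesis p_triangle : forall x y, (p (x + y)%R <= p x + p y)%E.
Hypotheses (beta_gt0 : 0 < beta) (lambda_gt0 : forall n, 0 < lambda n).
Hypotheses (a_ge0 : forall n, 0 <= a n) (a_noninc : forall n, a n.+1 <= a n).
Hypothesis E_fin : exists x, E x /\ (p x < +oo)%E.
Hypothesis sigma_min :
  multiscale_seq E N Nhat p alpha beta gamma lambda a sigma.

Local Notation misfit := (penalized_misfit N Nhat p alpha gamma).
Local Notation obj := (objective N Nhat p alpha beta gamma).

(** Meant for points of finite penalty, where it is the penalized misfit; [fine] sends [+oo] to
    [0]. *)
Definition real_misfit (b : R) (x : X) : R :=
  mdist Nhat (N x) `^ alpha + b * fine (p x) `^ gamma.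

Lemma fin_num_penalty {x} : (p x < +oo)%E -> p x \is a fin_num.
Proof. by rewrite ge0_fin_numE. Qed.

Lemma penalty_add_lty x y :
  (p x < +oo)%E -> (p y < +oo)%E -> (p (x + y)%R < +oo)%E.
Proof.
move=> px py; apply: le_lt_trans (p_triangle x y) _.
by rewrite lte_add_pinfty.
Qed.

Lemma penalized_misfitE b x : (p x < +oo)%E ->
  misfit b x = (real_misfit b x)%:E.
Proof.
by move=> /fin_num_penalty px; rewrite /penalized_misfit -(fineK px) poweR_EFin.
Qed.

Lemma objectiveE l b x s : (p (x + s)%R < +oo)%E -> (p s < +oo)%E ->
  obj l b x s =
  (l * real_misfit b (x + s) + fine (p s) `^ beta)%:E.
Proof.
move=> pxs /fin_num_penalty ps.
by rewrite /objective penalized_misfitE// -{1}(fineK ps) poweR_EFin.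
Qed.

(** As [beta] is positive, an infinite [p s] makes the last summand [+oo], and the nonnegative first
    summand cannot cancel it. *)
Lemma objective_lty l b x s : 0 <= l -> 0 <= b ->
  (obj l b x s < +oo)%E -> (p s < +oo)%E.
Proof.
move=> l0 b0; apply: contraTT; rewrite -!leNgt !leye_eq => /eqP ps.
rewrite /objective ps poweRyr ?(gt_eqF beta_gt0)// addey// gt_eqF//.
apply: (@lt_le_trans _ _ 0%E); rewrite ?ltNy0 ?mule_ge0 ?lee_fin//.
by rewrite adde_ge0 ?mule_ge0 ?lee_fin ?powR_ge0 ?poweR_ge0.
Qed.

Lemma psumS n : psum sigma n.+1 = psum sigma n + sigma n.+1.
Proof. by rewrite /psum big_ord_recr. Qed.

(** The zero increment is admissible with a finite objective, so the minimal value is finite. *)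
Lemma step_penalty_lty n : E (psum sigma n) -> (p (psum sigma n) < +oo)%E ->
  (p (sigma n.+1) < +oo)%E.
Proof.
move=> En pn; have [_ /(_ n) [_ minS]] := sigma_min.
apply: (@objective_lty (lambda n.+1) (a n.+1) (psum sigma n)).
- exact: ltW.
- exact: a_ge0.
- apply: (@le_lt_trans _ _ (obj (lambda n.+1) (a n.+1) (psum sigma n) 0)).
    by apply: minS; rewrite /= addr0.
  by rewrite objectiveE ?addr0 ?p0 ?ltry.
Qed.

Lemma psum_finite n : E (psum sigma n) /\ (p (psum sigma n) < +oo)%E.
Proof.
elim: n => [|n [En pn]].
  have [[E0 min0] _] := sigma_min; have [x [Ex px]] := E_fin.
  rewrite /psum big_ord1; split=> //.
  apply: (@objective_lty (lambda 0%N) (a 0%N) 0) => //; first exact: ltW.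
  apply: le_lt_trans (min0 _ Ex) _.
  by rewrite objectiveE ?add0r ?ltry.
rewrite psumS; split; first exact: (sigma_min.2 n).1.
by apply: penalty_add_lty => //; exact: step_penalty_lty.
Qed.

Lemma sigma_penalty_lty n : (p (sigma n.+1) < +oo)%E.
Proof. by have [En pn] := psum_finite n; exact: step_penalty_lty. Qed.

(** The competitor is the increment [x - psum sigma n], which leads to [x]; all penalties being
    finite, the comparison takes place in the reals. *)
Lemma real_minimality n x : E x -> (p x < +oo)%E ->
  (p (x - psum sigma n)%R < +oo)%E ->
  lambda n.+1 * real_misfit (a n.+1) (psum sigma n.+1)
    + fine (p (sigma n.+1)) `^ beta
  <= lambda n.+1 * real_misfit (a n.+1) x
    + fine (p (x - psum sigma n)) `^ beta.
Proof.
move=> Ex px pxn; have [_ /(_ n) [ES minS]] := sigma_min.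
have := minS (x - psum sigma n); rewrite /= addrC subrK => /(_ Ex).
rewrite !objectiveE ?lee_fin -?psumS ?[_ + (x - _)]addrC ?subrK//.
- exact: (psum_finite n.+1).2.
- exact: sigma_penalty_lty.
Qed.

Lemma real_misfit_noninc n :
  real_misfit (a n.+1) (psum sigma n.+1) <= real_misfit (a n) (psum sigma n).
Proof.
have [En pn] := psum_finite n.
have := real_minimality n _ En pn; rewrite subrr p0 ltry => /(_ isT).
rewrite powR0 ?gt_eqF// addr0 => h.
apply: (@le_trans _ _ (real_misfit (a n.+1) (psum sigma n))).
  rewrite -(ler_pM2l (lambda_gt0 n.+1)); apply: le_trans h.
  by rewrite lerDl powR_ge0.
by rewrite lerD2l ler_wpM2r ?powR_ge0.
Qed.

(** * Descent of the penalized misfits under the growth of [lambda] *)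

Hypothesis pN : forall x, p (- x) = p x.
Hypothesis a_cvg0 : a @ \oo --> (0 : R).
Hypothesis lambda_growth : (limn_esup (fun n : nat =>
  ((2 : R) `^ (beta * n%:R) / lambda n)%:E) < +oo)%E.

Lemma real_misfit_lt (z : X) (L : R) : E z -> (p z < +oo)%E ->
  mdist Nhat (N z) `^ alpha < L ->
  exists n, real_misfit (a n) (psum sigma n) < L.
Proof.
move=> Ez pz zL; apply: contrapT => /forallNP nL.
have {}nL n : L <= real_misfit (a n) (psum sigma n).
  by rewrite leNgt; apply/negP/nL.
(* Half of the gap absorbs the vanishing penalty term of [z]; the other half remains as [c]. *)
pose c := (L - mdist Nhat (N z) `^ alpha) / 2.
have c0 : 0 < c by rewrite divr_gt0// subr_gt0.
have near_c : \forall n \near \oo, real_misfit (a n) z <= L - c.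
  have : (fun n => real_misfit (a n) z) @ \oo --> mdist Nhat (N z) `^ alpha.
    rewrite -[X in _ --> X]addr0 -(mul0r (fine (p z) `^ gamma)).
    apply: cvgD; first exact: cvg_cst.
    by apply: cvgM => //; exact: cvg_cst.
  by move/cvgr_le; apply; rewrite /c; lra.
have [M near_M] := limn_esup_bounded _ _ lambda_growth.
have [n0 _ n0P] := filterI near_c near_M.
(* The maximum with [1] makes the bound positive, hence invertible. *)
pose M1 := Num.max M 1.
have M1_gt0 : 0 < M1 by rewrite lt_max ltr01 orbT.
(* The shift by [n0] makes both eventual bounds hold at every index. *)
pose r n := fine (p (z - psum sigma (n + n0)%N)).
pose s n := fine (p (sigma (n + n0).+1)).
have pzn n : (p (z - psum sigma n)%R < +oo)%E.
  by apply: penalty_add_lty; rewrite ?pN//; exact: (psum_finite n).2.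
have lambda_ge n : (n0 <= n)%N -> M1^-1 * 2 `^ (beta * n%:R) <= lambda n.
  move=> /n0P [_]; rewrite ler_pdivrMr// => h.
  rewrite mulrC ler_pdivrMr// [lambda n * _]mulrC; apply: le_trans h _.
  by rewrite ler_wpM2r ?(ltW (lambda_gt0 n))// le_max lexx.
apply: (@powR_gap_doubling R beta (c * M1^-1) r s) => //.
- by rewrite mulr_gt0// invr_gt0.
- by move=> n; rewrite fine_ge0.
- by move=> n; rewrite fine_ge0.
- move=> n; set m := (n + n0)%N.
  have m0 : (n0 <= m.+1)%N by rewrite leqW// leq_addl.
  have h := real_minimality m z Ez pz (pzn m).
  have h1 : c * lambda m.+1 <= lambda m.+1 *
      (real_misfit (a m.+1) (psum sigma m.+1) - real_misfit (a m.+1) z).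
    rewrite mulrC ler_pM2l//; have [/= h2 _] := n0P _ m0.
    by have := nL m.+1; lra.
  (* The growth bound at index [m.+1] is weakened to the smaller exponent [beta * n]. *)
  have h3 : c * M1^-1 * 2 `^ (beta * n%:R) <= c * lambda m.+1.
    rewrite -mulrA ler_pM2l//; apply: le_trans (lambda_ge _ m0).
    rewrite ler_pM2l ?invr_gt0// ler_powR ?ler1n// ler_pM2l// ler_nat.
    by rewrite leqW// leq_addr.
  by rewrite /r /s -/m; lra.
(* The new difference is the old one minus [sigma m.+1]; subadditivity and the symmetry of [p]
   conclude. *)
- move=> n; rewrite /r /s addSn psumS opprD addrA.
  set m := (n + n0)%N.
  rewrite -fineD ?fin_num_penalty ?sigma_penalty_lty//.
  rewrite fine_le ?fin_numD ?fin_num_penalty ?sigma_penalty_lty//.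
    by apply: penalty_add_lty; rewrite ?pN ?sigma_penalty_lty.
  by rewrite -(pN (sigma m.+1)); exact: p_triangle.
Qed.

End multiscale_seq_theory.

(** * Convergence of the misfits to their infimum *)

Theorem theorem2p5 (R : realType) (X : completeNormedModType R)
    (E : set X) (Y : metricType R) (N : X -> Y) (Nhat : Y)
    (p : X -> \bar R) (alpha beta gamma : R)
    (lambda a : nat -> R) (sigma : nat -> X)
    (Eclosed : closed E) (Enonempty : E !=set0)
    (dist_cont : {within E, continuous (fun x : X => mdist Nhat (N x))})
    (p_ge0 : forall x, (0 <= p x)%E)
    (p0 : p 0 = 0%E) (pN : forall x, p (- x) = p x)
    (p_triangle : forall x y, (p (x + y)%R <= p x + p y)%E)
    (p_dense : E `<=` closure (E `&` [set x | (p x < +oo)%E]))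
    (p_compact : forall b : R, relatively_seq_compact [set x | (p x <= b%:E)%E])
    (p_lsc : seq_lower_semicontinuous p)
    (alpha_gt0 : 0 < alpha) (beta_gt0 : 0 < beta) (gamma_gt0 : 0 < gamma)
    (lambda_gt0 : forall n, 0 < lambda n) (a_ge0 : forall n, 0 <= a n)
    (a_noninc : forall n, a n.+1 <= a n)
    (a_cvg0 : a @ \oo --> (0 : R))
    (lambda_growth :
      (limn_esup (fun n : nat =>
         ((2 : R) `^ (beta * n%:R) / lambda n)%:E) < +oo)%E)
    (sigma_min : multiscale_seq E N Nhat p alpha beta gamma lambda a sigma) :
  let delta0 : R := inf [set mdist Nhat (N x) | x in E] in
  let u : nat -> \bar R := fun n =>
    (penalized_misfit N Nhat p alpha gamma (a n) (psum sigma n)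
       `^ alpha^-1)%E in
  let eps0 : \bar R := limn u in
  [/\ nonincreasing_seq u,
      cvgn u,
      eps0 = delta0%:E
    & (fun n => mdist Nhat (N (psum sigma n))) @ \oo --> delta0].
Proof.
move=> delta0 u eps0.
have alpha_neq0 : alpha != 0 by rewrite gt_eqF.
pose D x := mdist Nhat (N x).
have D0 x : 0 <= D x by exact: mdist_ge0.
have Dnonempty : [set D x | x in E] !=set0.
  by case: Enonempty => x Ex; exists (D x), x.
have delta0_le x : E x -> delta0 <= D x.
  by move=> Ex; apply: ge_inf; [exists 0 => _ [y _ <-]; exact: D0|exists x].
(* A near-minimizer may have infinite penalty; density and continuity replace it by a point of
   finite penalty. *)
have approx y : delta0 < y ->
    exists z, [/\ E z, (p z < +oo)%E & D z < y].
  move=> /(inf_lt Dnonempty)[_ [x Ex <-]] xy.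
  exact: (within_continuous_lt_dense _ _ _ _ _ _ _ dist_cont p_dense Ex xy).
have E_fin : exists x, E x /\ (p x < +oo)%E.
  have [|z [Ez pz _]] := approx (delta0 + 1); first by rewrite ltrDl.
  by exists z.
pose f n := real_misfit N Nhat p alpha gamma (a n) (psum sigma n).
have fin n : E (psum sigma n) /\ (p (psum sigma n) < +oo)%E.
  exact: (psum_finite E N Nhat p alpha beta gamma lambda a).
pose v n := f n `^ alpha^-1.
have uE : u = EFin \o v.
  by apply/funext => n; rewrite /u penalized_misfitE ?(fin n).2// poweR_EFin.
have Df n : D (psum sigma n) `^ alpha <= f n.
  by rewrite lerDl mulr_ge0 ?powR_ge0.
have f0 n : 0 <= f n by apply: le_trans (Df n); exact: powR_ge0.
have v_noninc : {homo v : m n / (m <= n)%N >-> n <= m}.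
  apply/nonincreasing_seqP => n.
  rewrite ler_powR2r ?invr_gt0//.
  exact: (real_misfit_noninc E N Nhat p alpha beta gamma lambda a).
have Dv n : D (psum sigma n) <= v n.
  by rewrite -(powRK alpha_neq0 (D0 _)) ler_powR2r ?invr_gt0 ?powR_ge0.
(* Always [delta0 <= D <= v], and [v] is nonincreasing, so a single index with [v n < delta0 + e]
   suffices. *)
have v_cvg : v @ \oo --> delta0.
  apply/cvgrPdist_lt => e e0.
  have [|z [Ez pz zL]] := approx (delta0 + e); first by rewrite ltrDl.
  have de0 : 0 <= delta0 + e by apply: le_trans (ltW zL).
  have [|n fn] := real_misfit_lt E N Nhat p alpha beta gamma lambda a sigma
    p_ge0 p0 p_triangle beta_gt0 lambda_gt0 a_ge0 E_fin sigma_min pN a_cvg0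
    lambda_growth z ((delta0 + e) `^ alpha) Ez pz.
    by rewrite gt0_ltr_powR ?nnegrE ?mdist_ge0.
  exists n => // m /= nm.
  have vm : v m < delta0 + e.
    apply: le_lt_trans (v_noninc _ _ nm) _.
    by rewrite -(powRK alpha_neq0 de0) gt0_ltr_powR ?invr_gt0 ?nnegrE ?powR_ge0.
  have := delta0_le _ (fin m).1; have := Dv m => h1 h2.
  by rewrite distrC ger0_norm; lra.
have u_cvg : u @ \oo --> delta0%:E.
  by rewrite uE; apply: cvg_comp v_cvg _.
split.
- by rewrite uE => m n mn; rewrite lee_fin; exact: v_noninc.
- by apply/cvg_ex; exists delta0%:E.
- exact: cvg_lim.
- apply: (squeeze_cvgr _ (cvg_cst delta0) v_cvg).
  by apply: nearW => n; rewrite Dv (delta0_le _ (fin n).1).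
Qed.
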